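(* Let $0\le t<1$. The operator norms of $C_t$ are given by $$\|C_t\|_{c_0\to c_0}=1=\|C_t\|_{c\to c}.$$ Moreover, $C_t$ is compact in both $c_0$ and $c$ and has spectra $$\sigma_{pt}(C_t;c_0)=\sigma_{pt}(C_t;c)=\Lambda\quad\text{and}\quad\sigma(C_t;c_0)=\sigma(C_t;c)=\Lambda_0.$$ Also, $C_t$ is power bounded and uniformly mean ergodic in both $c_0$ and $c$ but fails to be supercyclic in both $c_0$ and $c$.
   Context: Sequences are complex and indexed by $\mathbb{N}_0=\{0,1,2,\dots\}$. $c$ (resp. $c_0$) is the Banach space of convergent (resp. null) sequences with the sup norm. For $t\in[0,1]$ the generalized Cesàro operator is $C_tx=\big(\frac{t^nx_0+t^{n-1}x_1+\dots+x_n}{n+1}\big)_{n\in\mathbb{N}_0}$, with $t^0=1$ also for $t=0$. $\Lambda:=\{\frac1{n+1}:n\in\mathbb{N}_0\}$ and $\Lambda_0:=\Lambda\cup\{0\}$. $\sigma(T;X)$ and $\sigma_{pt}(T;X)$ are the spectrum and point spectrum (set of eigenvalues) of a bounded operator $T$ on a Banach space $X$. With $T_{[n]}:=\frac1n\sum_{m=1}^nT^m$, $T$ is uniformly mean ergodic if $(T_{[n]})_{n\geq 1}$ converges in operator norm; power bounded if $\sup_{n\ge1}\|T^n\|<\infty$; supercyclic if there is $x\in X$ with $\{\lambda T^nx:\lambda\in\mathbb{C},n\in\mathbb{N}_0\}$ dense in $X$. *)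

(* Defs.v *)
From HB Require Import structures.
From mathcomp Require Import all_boot all_order all_algebra.
From mathcomp Require Import all_classical all_reals all_analysis.
From mathcomp.real_closed Require Import complex.

Set Implicit Arguments.
Unset Strict Implicit.
Unset Printing Implicit Defensive.

Import Order.TTheory GRing.Theory Num.Theory.
Import numFieldNormedType.Exports.

Local Open Scope classical_set_scope.
Local Open Scope ring_scope.
Local Open Scope complex_scope.

(* The topology of R[i] given by its modulus; the library only declares it on
   the alias R[i]^o. *)
HB.instance Definition _ (R : realType) := NormedModule.copy R[i] R[i]^o.

(* Norms on a normedModType R[i] take their values in R[i]; they are
   nonnegative, hence real, and [complex.Re `|x|] is the norm of x as an
   element of R. *)

Section Operators.
Variables (R : realType) (X : normedModType R[i]).
Implicit Types T : X -> X.

(* Valued in \bar R, so that it is +oo on unbounded linear maps. *)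
Definition opnorm T : \bar R :=
  ereal_sup [set (complex.Re `|T x|)%:E | x in [set x : X | `|x| <= 1]].

Definition compact_operator T :=
  precompact (T @` [set x : X | `|x| <= 1]).

Definition point_spectrum T : set R[i] :=
  [set l | exists2 x : X, x != 0 & T x = l *: x].

(* A two-sided inverse in the algebra of bounded operators. *)
Definition resolvent_set T : set R[i] :=
  [set l | exists S : {linear X -> X}, [/\ continuous S,
     cancel (fun x => l *: x - T x) S & cancel S (fun x => l *: x - T x)]].

Definition spectrum T : set R[i] := ~` resolvent_set T.

Definition power_bounded T :=
  (ereal_sup [set opnorm (iter n T) | n in [set n | (1 <= n)%N]] < +oo)%E.

(* The value at n = 0 is irrelevant to the limit below. *)
Definition cesaro_mean T (n : nat) (x : X) : X :=
  n%:R^-1 *: \sum_(1 <= m < n.+1) iter m T x.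

Definition uniformly_mean_ergodic T :=
  exists2 P : {linear X -> X}, continuous P &
    opnorm (fun x => cesaro_mean T n x - P x) @[n --> \oo] --> 0%E.

Definition supercyclic T :=
  exists x : X, dense [set y | exists l n, y = l *: iter n T x].

End Operators.

Section SupNorm.
Variable R : realType.
Implicit Types x y : nat -> R[i].

(* The sup is only meaningful on bounded sequences. *)
Definition supnorm x : R := sup (range (fun n => complex.Re `|x n|)).

Lemma normRe (z : R[i]) : `|z| = (complex.Re `|z|)%:C.
Proof. by rewrite normc_def. Qed.

Lemma Re_norm_ge0 (z : R[i]) : 0 <= complex.Re `|z|.
Proof. by rewrite -ler0c -normRe normr_ge0. Qed.

Lemma cvg_has_sup x : cvgn x -> has_sup (range (fun n => complex.Re `|x n|)).
Proof.
move=> /cvg_seq_bounded[M [_ xM]].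
split; first by exists (complex.Re `|x 0%N|), 0%N.
exists (complex.Re (M + 1)) => _ [n _ <-].
have M1 : M < M + 1 by rewrite ltrDl.
by have /= := xM _ M1 n I; rewrite lecE => /andP[].
Qed.

Lemma supnorm_ub x n : cvgn x -> `|x n| <= (supnorm x)%:C.
Proof.
move=> /cvg_has_sup[_ xub]; rewrite normRe lecR.
by apply: ub_le_sup => //; exists n.
Qed.

Lemma supnorm_le x (M : R) :
  (forall n, `|x n| <= M%:C) -> supnorm x <= M.
Proof.
move=> xM; apply: ge_sup; first by exists (complex.Re `|x 0%N|), 0%N.
by move=> _ [n _ <-]; rewrite -lecR -normRe.
Qed.

Lemma supnormD x y : cvgn x -> cvgn y ->
  (supnorm (x + y))%:C <= (supnorm x)%:C + (supnorm y)%:C.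
Proof.
move=> cx cy; rewrite -rmorphD lecR; apply: supnorm_le => n.
by rewrite rmorphD (le_trans (ler_normD _ _))// lerD// supnorm_ub.
Qed.

Lemma supnormZ (l : R[i]) x : cvgn x ->
  (supnorm (l *: x))%:C = `|l| * (supnorm x)%:C.
Proof.
have le1 k y : cvgn y -> (supnorm (k *: y))%:C <= `|k| * (supnorm y)%:C.
  move=> cy; rewrite normRe -rmorphM lecR; apply: supnorm_le => n.
  by rewrite rmorphM /= -normRe normrM ler_wpM2l// supnorm_ub.
move=> cx; apply/le_anti/andP; split; first exact: le1.
have [->|l0] := eqVneq l 0.
  rewrite normr0 mul0r ler0c; apply: le_trans (Re_norm_ge0 ((0 *: x) 0%N)) _.
  have c0x : cvgn (0 *: x) by rewrite scale0r; exact: is_cvg_cst.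
  by rewrite -lecR -normRe supnorm_ub.
rewrite -ler_pdivlMl ?normr_gt0// -normfV.
have {1}-> : x = l^-1 *: (l *: x) by rewrite scalerA mulVf// scale1r.
by apply: le1; exact: is_cvgZl_tmp.
Qed.

Lemma supnorm0_eq0 x : cvgn x -> (supnorm x)%:C = 0 -> x = 0.
Proof.
move=> cx x0; apply/funext => n; apply/eqP.
by rewrite -normr_le0 -x0 supnorm_ub.
Qed.

Definition cvg_seqs : {pred nat -> R[i]} := [pred x | `[< cvgn x >]].

Definition null_seqs : {pred nat -> R[i]} :=
  [pred x | `[< x @ \oo --> (0 : R[i]) >]].

Lemma is_cvg_lin (l : R[i]) x y : cvgn x -> cvgn y -> cvgn (l *: x + y).
Proof.
move=> cx cy; exact: is_cvgD (is_cvgZl_tmp (k := l) cx) cy.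
Qed.

Lemma cvg0_lin (l : R[i]) x y : x @ \oo --> (0 : R[i]) ->
  y @ \oo --> (0 : R[i]) -> l *: x + y @ \oo --> (0 : R[i]).
Proof.
move=> cx cy; have := cvgD (cvgZl_tmp (k := l) cx) cy.
by rewrite scaler0 addr0; apply.
Qed.

Lemma cvg_seqs_submod : submod_closed cvg_seqs.
Proof.
split; first by apply/asboolP; exact: is_cvg_cst.
by move=> l x y /asboolP cx /asboolP cy; apply/asboolP; exact: is_cvg_lin cx cy.
Qed.

Lemma null_seqs_submod : submod_closed null_seqs.
Proof.
split; first by apply/asboolP; exact: cvg_cst.
by move=> l x y /asboolP cx /asboolP cy; apply/asboolP; exact: cvg0_lin cx cy.
Qed.

HB.instance Definition _ :=
  GRing.isSubmodClosed.Build _ _ cvg_seqs cvg_seqs_submod.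
HB.instance Definition _ :=
  GRing.isSubmodClosed.Build _ _ null_seqs null_seqs_submod.

Record cspace := CSpace { cseq :> nat -> R[i]; cseqP : cseq \in cvg_seqs }.
Record c0space := C0Space { c0seq :> nat -> R[i]; c0seqP : c0seq \in null_seqs }.

HB.instance Definition _ := [isSub for cseq].
HB.instance Definition _ := [Choice of cspace by <:].
HB.instance Definition _ := [SubChoice_isSubLmodule of cspace by <:].
HB.instance Definition _ := [isSub for c0seq].
HB.instance Definition _ := [Choice of c0space by <:].
HB.instance Definition _ := [SubChoice_isSubLmodule of c0space by <:].

Lemma cspace_cvg (x : cspace) : cvgn x.
Proof. by apply/asboolP; exact: cseqP. Qed.

Lemma c0space_cvg0 (x : c0space) : x @ \oo --> (0 : R[i]).
Proof. by apply/asboolP; exact: c0seqP. Qed.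

Lemma c0space_cvg (x : c0space) : cvgn x.
Proof. by apply/cvg_ex; exists 0; exact: c0space_cvg0. Qed.

Definition cnorm (x : cspace) : R[i] := (supnorm x)%:C.
Definition c0norm (x : c0space) : R[i] := (supnorm x)%:C.

Lemma cnormD (x y : cspace) : cnorm (x + y) <= cnorm x + cnorm y.
Proof. by apply: supnormD; exact: cspace_cvg. Qed.

Lemma cnormZ (l : R[i]) (x : cspace) : cnorm (l *: x) = `|l| * cnorm x.
Proof. by apply: supnormZ; exact: cspace_cvg. Qed.

Lemma cnorm0_eq0 (x : cspace) : cnorm x = 0 -> x = 0.
Proof. by move=> x0; apply/val_inj/supnorm0_eq0 => //; exact: cspace_cvg. Qed.

Lemma c0normD (x y : c0space) : c0norm (x + y) <= c0norm x + c0norm y.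
Proof. by apply: supnormD; exact: c0space_cvg. Qed.

Lemma c0normZ (l : R[i]) (x : c0space) : c0norm (l *: x) = `|l| * c0norm x.
Proof. by apply: supnormZ; exact: c0space_cvg. Qed.

Lemma c0norm0_eq0 (x : c0space) : c0norm x = 0 -> x = 0.
Proof. by move=> x0; apply/val_inj/supnorm0_eq0 => //; exact: c0space_cvg. Qed.

HB.instance Definition _ :=
  Lmodule_isNormed.Build R[i] cspace cnormD cnormZ cnorm0_eq0.
HB.instance Definition _ :=
  Lmodule_isNormed.Build R[i] c0space c0normD c0normZ c0norm0_eq0.

Lemma cspace_normE (x : cspace) : `|x| = (supnorm x)%:C.
Proof. by []. Qed.

Lemma c0space_normE (x : c0space) : `|x| = (supnorm x)%:C.
Proof. by []. Qed.

End SupNorm.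

Section Cesaro.
Variable R : realType.
Implicit Types (t : R) (x : nat -> R[i]).

(* 0 ^+ 0 = 1, so t ^+ 0 = 1 also for t = 0. *)
Definition cesaro t x : nat -> R[i] :=
  fun n => (\sum_(i < n.+1) t%:C ^+ (n - i) * x i) / n.+1%:R.

Lemma cesaroP t (l : R[i]) x y :
  cesaro t (l *: x + y) = l *: cesaro t x + cesaro t y.
Proof.
apply/funext => n; rewrite /cesaro.
rewrite [RHS](_ : _ = l * (cesaro t x n) + cesaro t y n)// /cesaro.
rewrite mulrA -mulrDl mulr_sumr -big_split; congr (_ / _) => /=.
by apply: eq_bigr => i _; rewrite mulrDr mulrCA.
Qed.

Lemma cesaro_cvg0 t x : 0 <= t < 1 -> cvgn x ->
  cesaro t x @ \oo --> (0 : R[i]).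
Proof.
move=> /andP[t0 t1] cx; pose M := supnorm x / (1 - t).
have x0 : 0 <= supnorm x.
  by rewrite -ler0c (le_trans _ (supnorm_ub 0 cx)).
have xM n : `|cesaro t x n| <= (M / n.+1%:R)%:C.
  rewrite normf_div rmorphM /= fmorphV rmorph_nat normr_nat ler_wpM2r//.
  apply: (le_trans (ler_norm_sum _ _ _)).
  have le1 (i : 'I_n.+1) : true -> `|t%:C ^+ (n - i) * x i|
      <= (t ^+ (n - i) * supnorm x)%:C.
    move=> _; rewrite normrM rmorphM rmorphXn normrX ger0_norm ?ler0c//.
    by rewrite ler_wpM2l ?supnorm_ub// exprn_ge0// ler0c.
  apply: (le_trans (ler_sum _ le1)); rewrite -rmorph_sum lecR -mulr_suml.
  rewrite mulrC /M ler_wpM2l//.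
  have -> : \sum_(i < n.+1) t ^+ (n - i) = \sum_(i < n.+1) t ^+ i.
    rewrite (reindex_inj rev_ord_inj)/=.
    by apply: eq_bigr => i _; rewrite subSS subKn// leq_ord.
  have -> : \sum_(i < n.+1) t ^+ i = (1 - t ^+ n.+1) / (1 - t).
    apply: (mulIf (lt0r_neq0 _ : 1 - t != 0)); first by rewrite subr_gt0.
    rewrite divfK ?lt0r_neq0 ?subr_gt0// mulrC.
    by rewrite -[1 - t]opprB mulNr -subrX1 opprB.
  apply: ler_piMl; first by rewrite invr_ge0 subr_ge0 ltW.
  by rewrite gerBl exprn_ge0.
apply/cvgr0Pnorm_le => e e0.
have eR : e = (complex.Re e)%:C by rewrite -{1}(gtr0_norm e0) normRe gtr0_norm.
have : (fun n => M / n.+1%:R) @ \oo --> (0 : R).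
  rewrite -(mulr0 M); apply: cvgM; first exact: cvg_cst.
  exact: cvg_harmonic.
move=> /cvgr0Pnorm_le /(_ (complex.Re e)); rewrite -ltcR -eR => /(_ e0).
apply: filterS => n; rewrite eR => h; apply: (le_trans (xM n)).
by rewrite lecR (le_trans (ler_norm _)).
Qed.

Variables (t : R) (ht : 0 <= t < 1).

Lemma cesaro_c_subproof (x : cspace R) : cesaro t x \in @cvg_seqs R.
Proof.
by apply/asboolP/cvg_ex; exists 0; apply: cesaro_cvg0 => //; exact: cspace_cvg.
Qed.

Lemma cesaro_c0_subproof (x : c0space R) : cesaro t x \in @null_seqs R.
Proof. by apply/asboolP; apply: cesaro_cvg0 => //; exact: c0space_cvg. Qed.

Definition cesaro_c (x : cspace R) : cspace R := CSpace (cesaro_c_subproof x).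
Definition cesaro_c0 (x : c0space R) : c0space R :=
  C0Space (cesaro_c0_subproof x).

Lemma cesaro_c_linear : linear cesaro_c.
Proof. by move=> l x y; apply: val_inj; exact: cesaroP. Qed.

Lemma cesaro_c0_linear : linear cesaro_c0.
Proof. by move=> l x y; apply: val_inj; exact: cesaroP. Qed.

HB.instance Definition _ :=
  GRing.isLinear.Build R[i] (cspace R) (cspace R) _ cesaro_c cesaro_c_linear.
HB.instance Definition _ :=
  GRing.isLinear.Build R[i] (c0space R) (c0space R) _ cesaro_c0 cesaro_c0_linear.

End Cesaro.

Section Lambda.
Variable R : realType.

Definition Lambda : set R[i] := range (fun n : nat => n.+1%:R^-1).
Definition Lambda0 : set R[i] := Lambda `|` [set 0].

End Lambda.

Arguments Lambda : clear implicits.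
Arguments Lambda0 : clear implicits.

(* Main.v *)
(* Everything happens for a bounded sequence space X normed by the supremum and
   containing all null sequences, which covers c_0 and c.  In the standard
   basis C_t is a lower triangular matrix with diagonal 1/(n+1), whose n-th row
   sums to at most min(1, 1/((1-t)(n+1))): so C_t is a contraction mapping the
   unit ball into a compact set of sequences dominated by a fixed null sequence.
   The eigenvectors are C(n,k) t^(n-k), bounded by (1-t)^-k since
   (t + (1-t))^n = 1.  For l != 0 off the diagonal, l x - C_t x = y is solved
   recursively, and the decay of the rows bounds x by a multiple of y.  The same
   bound at l = 1, for sequences vanishing at 0, shows that the Cesaro means of
   the powers of C_t converge at speed 1/n to the projection
   x |-> x_0 (t^n)_n.  Finally, the dual of C_t has two independent
   eigenvectors, which excludes supercyclicity. *)
Require Import Defs.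
From HB Require Import structures.
From mathcomp Require Import all_boot all_order all_algebra.
From mathcomp Require Import all_classical all_reals all_analysis.
From mathcomp.real_closed Require Import complex.
From mathcomp Require Import ring lra.

Set Implicit Arguments.
Unset Strict Implicit.
Unset Printing Implicit Defensive.

Import Order.TTheory GRing.Theory Num.Theory.
Import numFieldNormedType.Exports.

Local Open Scope classical_set_scope.
Local Open Scope ring_scope.

Local Notation nc z := (complex.Re `|z|).
(* [sequences] exports a lemma of that name. *)
Local Notation cesaro := Defs.cesaro.
Local Notation "r %:C" := (real_complex _ r) : ring_scope.

(** * Real-valued moduli and compact squares in the complex plane *)

Section Modulus.
Variable R : realType.
Implicit Types z w : R[i].

Lemma ncE (X : normedModType R[i]) (x : X) : `|x| = (nc x)%:C.
Proof. by apply/esym/RRe_real; rewrite ger0_real. Qed.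

Lemma nc_ge0 (X : normedModType R[i]) (x : X) : 0 <= nc x.
Proof. by rewrite -ler0c -ncE. Qed.

Lemma ncM z w : nc (z * w) = nc z * nc w.
Proof. by rewrite normrM (normRe z) (normRe w) -rmorphM. Qed.

Lemma ncD (X : normedModType R[i]) (x y : X) : nc (x + y) <= nc x + nc y.
Proof. by rewrite -lecR rmorphD /= -!ncE ler_normD. Qed.

Lemma ncZ (X : normedModType R[i]) z (x : X) : nc (z *: x) = nc z * nc x.
Proof. by rewrite normrZ (ncE z) (ncE x) -rmorphM. Qed.

Lemma ncV z : nc z^-1 = (nc z)^-1.
Proof. by rewrite normfV (normRe z) -fmorphV. Qed.

Lemma nc_real (r : R) : nc (r%:C) = `|r|.
Proof. by rewrite normc_def /= expr0n /= addr0 sqrtr_sqr. Qed.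

Lemma nc_nat n : nc (n%:R : R[i]) = n%:R.
Proof. by rewrite -(rmorph_nat (real_complex R)) nc_real ger0_norm. Qed.

Lemma nc_sum n (f : 'I_n -> R[i]) (g : 'I_n -> R) :
  (forall i, nc (f i) <= g i) -> nc (\sum_i f i) <= \sum_i g i.
Proof.
move=> fg; rewrite -lecR -normRe (le_trans (ler_norm_sum _ _ _))//.
by rewrite rmorph_sum; apply: ler_sum => i _; rewrite normRe lecR.
Qed.

(** The image of a real square, so that compactness follows from that of real segments. It lies
    between the discs of radius [M] and [2 * M]. *)
Definition complex_square (M : R) : set R[i] :=
  (fun p : R * R => p.1%:C + 'i%C * p.2%:C) @` (`[- M, M] `*` `[- M, M]).

Lemma mem_complex_square M z : nc z <= M -> complex_square M z.
Proof.
move=> zM; exists (complex.Re z, complex.Im z); last by rewrite -complexE.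
have zM' : Num.sqrt (complex.Re z ^+ 2 + complex.Im z ^+ 2) <= M.
  by move: zM; rewrite normc_def.
split; rewrite /= in_itv/= -ler_norml; apply: le_trans zM';
  rewrite -sqrtr_sqr ler_wsqrtr//.
  by rewrite lerDl sqr_ge0.
by rewrite lerDr sqr_ge0.
Qed.

Lemma complex_square_le M z : complex_square M z -> nc z <= 2 * M.
Proof.
move=> [[a b] [aM bM] <-].
have {}aM : `|a| <= M by move: aM; rewrite /= in_itv/= -ler_norml.
have {}bM : `|b| <= M by move: bM; rewrite /= in_itv/= -ler_norml.
apply: le_trans (ncD _ _) _; rewrite ncM !nc_real.
have -> : nc ('i%C : R[i]) = 1.
  by rewrite normc_def /= expr0n expr1n add0r sqrtr1.
by rewrite mul1r mulr2n mulrDl mul1r lerD.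
Qed.

Lemma real_complex_continuous : continuous (real_complex R).
Proof.
move=> a; apply/cvgrPdist_le => e e0.
have eR : e = (nc e)%:C by rewrite -normRe gtr0_norm.
have e0' : 0 < nc e by rewrite -ltcR -eR.
have := @cvg_id _ (nbhs a); move=> /cvgrPdist_le /(_ _ e0').
by apply: filterS => b ab; rewrite -rmorphB normRe nc_real eR lecR.
Qed.

Lemma compact_complex_square M : compact (complex_square M).
Proof.
apply: continuous_compact; last by apply: compact_setX; exact: segment_compact.
apply: continuous_subspaceT => -[a b].
apply: cvgD.
  by apply: continuous_comp; [exact: cvg_fst|exact: real_complex_continuous].
apply: cvgM; first exact: cvg_cst.
by apply: continuous_comp; [exact: cvg_snd|exact: real_complex_continuous].
Qed.

End Modulus.

(** * Row estimates and the resolvent equation on arbitrary sequences *)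

Section CesaroSequences.
Variables (R : realType) (t : R).
Hypothesis t01 : 0 <= t < 1.
Implicit Types x y : nat -> R[i].

Lemma geometric_sum_le1 n : \sum_(i < n.+1) t ^+ (n - i) <= n.+1%:R.
Proof.
have /andP[t0 t1] := t01.
rewrite -[X in X%:R]card_ord -sum1_card natr_sum; apply: ler_sum => i _.
by rewrite exprn_ile1// ltW.
Qed.

Lemma geometric_sum_leV n : \sum_(i < n.+1) t ^+ (n - i) <= (1 - t)^-1.
Proof.
have /andP[t0 t1] := t01; have t1' : 0 < 1 - t by rewrite subr_gt0.
rewrite -[leRHS]mul1r ler_pdivlMr// (reindex_inj rev_ord_inj)/=.
under eq_bigr => i _ do rewrite subSS subKn ?leq_ord//.
by rewrite mulrC -opprB mulNr -subrX1 opprB gerBl exprn_ge0.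
Qed.

(** The powers of [t] in a row are at most 1 each, which gives contractivity, and their sum is below
    the geometric series, which gives decay. *)
Lemma cesaro_bound x n (M : R) : (forall i, (i <= n)%N -> nc (x i) <= M) ->
  nc (cesaro t x n) <= M /\ nc (cesaro t x n) <= M / (1 - t) / n.+1%:R.
Proof.
move=> xM; have /andP[t0 t1] := t01.
have M0 : 0 <= M by apply: le_trans (xM 0%N _) => //; exact: nc_ge0.
have le1 : nc (cesaro t x n) <= M * (\sum_(i < n.+1) t ^+ (n - i)) / n.+1%:R.
  rewrite ncM ncV nc_nat ler_wpM2r// mulr_sumr; apply: nc_sum => i.
  rewrite ncM mulrC -rmorphXn nc_real [`|t ^+ _|]ger0_norm ?exprn_ge0//.
  by rewrite ler_wpM2r ?exprn_ge0// xM// -ltnS.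
split; apply: (le_trans le1).
  by rewrite ler_pdivrMr// ler_wpM2l// geometric_sum_le1.
by rewrite ler_wpM2r// ler_wpM2l// geometric_sum_leV.
Qed.

Lemma cesaro_bounded_cvg0 x (M : R) : (forall n, nc (x n) <= M) ->
  cesaro t x @ \oo --> (0 : R[i]).
Proof.
move=> xM; apply/cvgr0Pnorm_le => e e0.
have eR : e = (nc e)%:C by rewrite -normRe gtr0_norm.
have : (fun n => M / (1 - t) / n.+1%:R) @ \oo --> (0 : R).
  rewrite -(mulr0 (M / (1 - t))); apply: cvgM; first exact: cvg_cst.
  exact: cvg_harmonic.
move=> /cvgr0Pnorm_le /(_ (nc e)); rewrite -ltcR -eR => /(_ e0).
apply: filterS => n h; rewrite eR normRe lecR.
apply: le_trans h; apply: le_trans (ler_norm _).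
by have [] := @cesaro_bound x n M (fun i _ => xM i).
Qed.

Lemma cesaroS x n : cesaro t x n.+1 =
  (t%:C * n.+1%:R * cesaro t x n + x n.+1) / n.+2%:R.
Proof.
rewrite /cesaro big_ord_recr /= subnn expr0 mul1r; congr ((_ + _) / _).
rewrite mulrA [RHS]mulrAC mulfK ?pnatr_eq0// mulr_sumr.
apply: eq_bigr => i _; rewrite subSn ?exprS ?mulrA//.
by rewrite -ltnS.
Qed.

Lemma cesaro0 x : cesaro t x 0 = x 0%N.
Proof. by rewrite /cesaro big_ord1 subnn expr0 mul1r divr1. Qed.

(* The solution of l x - C_t x = y, where resolvent_sum l y n.+1 is the sum of
   the t^(n-i) x_i for i <= n.  Where l = 1/(n+1), the division sets x_n = 0. *)
Fixpoint resolvent_sum (l : R[i]) y n : R[i] := if n is m.+1 then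
    t%:C * resolvent_sum l y m +
    (y m + t%:C * resolvent_sum l y m / m.+1%:R) / (l - m.+1%:R^-1)
  else 0.

Definition resolvent_seq (l : R[i]) y n : R[i] :=
  (y n + t%:C * resolvent_sum l y n / n.+1%:R) / (l - n.+1%:R^-1).

Lemma cesaro_resolvent l y n :
  cesaro t (resolvent_seq l y) n = resolvent_sum l y n.+1 / n.+1%:R.
Proof.
elim: n => [|n IH].
  by rewrite cesaro0 /resolvent_seq /= mulr0 add0r !divr1.
rewrite cesaroS IH [RHS]/=; congr ((_ + _) / _).
by rewrite mulrA mulrAC mulfK ?pnatr_eq0.
Qed.

(** The only resonance allowed is in row 0, where [resolvent_sum] vanishes and the equation reads 0
    = [y 0]. This is what the case l = 1 requires. *)
Lemma resolvent_seqP l y :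
  (forall n, l = n.+1%:R^-1 -> n = 0%N /\ y n = 0) ->
  l *: resolvent_seq l y - cesaro t (resolvent_seq l y) = y.
Proof.
move=> ly; apply/funext => n.
rewrite [LHS](_ : _ =
  l * resolvent_seq l y n - cesaro t (resolvent_seq l y) n)//.
rewrite cesaro_resolvent /resolvent_seq /=.
have [ln|ln] := eqVneq l n.+1%:R^-1.
  have [n0 yn] := ly _ ln; rewrite n0 in ln yn *.
  by rewrite ln subrr invr0 yn /= !(mulr0, mul0r, addr0, oppr0).
have ln' : l - n.+1%:R^-1 != 0 by rewrite subr_eq0.
set A := t%:C * _; set p := _^-1 in ln' *; rewrite [_ / n.+1%:R]mulrC -/p.
by field.
Qed.

(** Removing the diagonal term amounts to replacing the [n]-th entry by 0, so the row bounds apply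
    with earlier entries only. *)
Lemma cesaro_offdiag_bound x n (K : R) : 0 <= K ->
  (forall i, (i < n)%N -> nc (x i) <= K) ->
  nc (cesaro t x n - x n / n.+1%:R) <= K /\
  nc (cesaro t x n - x n / n.+1%:R) <= K / (1 - t) / n.+1%:R.
Proof.
move=> K0 xK; pose x' i := if i == n then 0 else x i.
have -> : cesaro t x n - x n / n.+1%:R = cesaro t x' n.
  rewrite /cesaro -mulrBl !big_ord_recr /= subnn expr0 !mul1r addrK.
  rewrite [x' n]/x' eqxx addr0; congr (_ / _); apply: eq_bigr => i _.
  by rewrite /x' ltn_eqF.
apply: cesaro_bound => i; rewrite /x' leq_eqVlt.
by case: eqP => [_ _|_ /= /xK//]; rewrite normr0.
Qed.

(** In a resonant row the coefficient of [x n] vanishes, so the equation cannot control that entry;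
    it is normalised to 0. *)
Definition resonance_free (l : R[i]) x := forall n, l = n.+1%:R^-1 -> x n = 0.

Lemma resolvent_step l x n (M L : R) :
  nc (l * x n - cesaro t x n) <= M ->
  nc (cesaro t x n - x n / n.+1%:R) <= L ->
  nc (l - n.+1%:R^-1) * nc (x n) <= M + L.
Proof.
move=> lM xL; rewrite -ncM.
have -> : (l - n.+1%:R^-1) * x n =
    (l * x n - cesaro t x n) + (cesaro t x n - x n / n.+1%:R).
  by rewrite mulrBl [_^-1 * _]mulrC addrA subrK.
by apply: le_trans (ncD _ _) _; exact: lerD.
Qed.

(** Over finitely many rows the constant may grow: row N enlarges B by (1 + B) / |l - 1/(N+1)|, and
    a resonant row contributes a zero entry. *)
Lemma resolvent_bound_prefix l N : exists2 B : R, 0 <= B &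
  forall x (M : R), resonance_free l x ->
    (forall n, nc (l * x n - cesaro t x n) <= M) ->
    forall n, (n < N)%N -> nc (x n) <= B * M.
Proof.
elim: N => [|N [B B0 IH]]; first by exists 0.
pose d := nc (l - N.+1%:R^-1); have d0 : 0 <= d^-1 by rewrite invr_ge0 nc_ge0.
exists (B + d^-1 * (1 + B)); first by rewrite addr_ge0// mulr_ge0// addr_ge0.
move=> x M lx xM n; have M0 : 0 <= M by apply: le_trans (xM 0%N); exact: nc_ge0.
rewrite ltnS leq_eqVlt => /orP[/eqP ->|nN]; last first.
  rewrite (le_trans (IH _ _ lx xM _ nN))// ler_wpM2r// lerDl mulr_ge0//.
  by rewrite addr_ge0.
have [lN|lN] := eqVneq l N.+1%:R^-1.
  by rewrite (lx _ lN) normr0 mulr_ge0// addr_ge0// mulr_ge0// addr_ge0.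
have [xL _] := cesaro_offdiag_bound (mulr_ge0 B0 M0) (IH _ _ lx xM).
have := resolvent_step (xM N) xL; rewrite -/d mulrC.
have dgt0 : 0 < d.
  rewrite lt_neqAle nc_ge0 andbT eq_sym -(inj_eq (@complexI R)) /= -ncE.
  by rewrite normr_eq0 subr_eq0.
rewrite -ler_pdivlMr// => /le_trans; apply.
have -> : (B + d^-1 * (1 + B)) * M = B * M + (M + B * M) / d by ring.
by rewrite lerDr mulr_ge0.
Qed.

(** Past a certain row the off-diagonal part is so small against |l| that strong induction carries
    the same constant from row to row. *)
Lemma resolvent_bound l : l != 0 -> exists2 B : R, 0 <= B &
  forall x (M : R), resonance_free l x ->
    (forall n, nc (l * x n - cesaro t x n) <= M) ->
    forall n, nc (x n) <= B * M.
Proof.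
move=> l0; have /andP[t0 t1] := t01; have t1' : 0 < 1 - t by rewrite subr_gt0.
have L0 : 0 < nc l by rewrite -ltcR -ncE normr_gt0.
pose Q := (1 - t)^-1; have Q0 : 0 < Q by rewrite invr_gt0.
(* From row [N] on, (Q + 1) / (n + 1) <= |l| / 2. *)
pose N := Num.bound ((Q + 1) * 2 / nc l).
have NP : (Q + 1) * 2 / nc l < N%:R.
  apply: archi_boundP; apply: divr_ge0; last exact: ltW.
  by apply: mulr_ge0 => //; apply: addr_ge0 => //; exact: ltW.
have [B1 B10 HB1] := resolvent_bound_prefix l N.
have Li0 : 0 <= 2 / nc l by rewrite divr_ge0// ltW.
(* [B1] covers the rows below [N]; the summand 2 / |l| absorbs the data, as M <= (|l| / 2) B M. *)
pose B := B1 + 2 / nc l; exists B; first by rewrite addr_ge0.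
move=> x M lx xM; have M0 : 0 <= M by apply: le_trans (xM 0%N); exact: nc_ge0.
have BM0 : 0 <= B * M by rewrite mulr_ge0// addr_ge0.
elim/ltn_ind => n IH; have [nN|Nn] := ltnP n N.
  by apply: le_trans (HB1 _ _ lx xM _ nN) _; rewrite ler_wpM2r// lerDl.
have [_ xL] := cesaro_offdiag_bound BM0 IH.
have := resolvent_step (xM n) xL; rewrite -[_ / (1 - t)]/(_ * Q).
set p : R := n.+1%:R^-1; set X := nc (x n) => stepX.
have p0 : 0 < p by rewrite invr_gt0.
have Np : (Q + 1) * p <= nc l / 2.
  rewrite ler_pdivlMr// mulrAC -ler_pdivlMr// /p invrK [leRHS]mulrC.
  rewrite -ler_pdivrMr// (le_trans (ltW NP))// ler_nat.
  exact: leq_trans Nn _.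
have X0 : 0 <= X by exact: nc_ge0.
have dl : nc l - p <= nc (l - n.+1%:R^-1).
  rewrite lerBlDr; have := ncD (l - n.+1%:R^-1) n.+1%:R^-1.
  by rewrite subrK ncV nc_nat.
have stepX' : (nc l - p) * X <= M + B * M * Q * p.
  by apply: le_trans stepX; rewrite ler_wpM2r.
have MB : M <= nc l / 2 * (B * M).
  rewrite mulrA ler_peMl// /B mulrDr -[leLHS]add0r lerD//.
    by rewrite mulr_ge0// divr_ge0// ltW.
  rewrite le_eqVlt; apply/orP; left; apply/eqP.
  by field; rewrite lt0r_neq0.
(* With K = B M, an entry X > K would give (|l| - p) K < (|l| / 2) K + Q p K, against (Q + 1) p <=
   |l| / 2. *)
rewrite leNgt; apply/negP => XB.
move: (B * M) BM0 XB MB stepX' => K K0 XK MK stepK.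
have Qp0 : 0 < Q * p by exact: mulr_gt0.
have cp : 0 < nc l - p by lra.
have : (nc l - p) * K < (nc l - p) * X by rewrite ltr_pM2l.
have := ler_wpM2r K0 Np.
lra.
Qed.

End CesaroSequences.

(** * Eigenvalues and eigenvectors *)

Section CesaroEigenvectors.
Variables (R : realType) (t : R).
Hypothesis t01 : 0 <= t < 1.
Implicit Types x y : nat -> R[i].

(** At the first nonzero entry the off-diagonal part of the row is 0, so the eigenvalue is the
    diagonal coefficient. *)
Lemma cesaro_eigenvalue l x : cesaro t x = l *: x -> x <> 0 ->
  exists n, l = n.+1%:R^-1.
Proof.
move=> xl x0; have ex : exists n, x n != 0.
  apply: contrapT => /forallNP h; apply: x0; apply/funext => n; apply/eqP.
  by apply: contrapT => /negP; exact: h.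
case: (ex_minnP ex) => n xn0 nmin; exists n.
have [||xn _] := @cesaro_offdiag_bound _ _ t01 x n 0 => //.
  move=> i ni; case: (eqVneq (x i) 0) => [->|/nmin]; first by rewrite normr0.
  by rewrite leqNgt ni.
move: xn; rewrite xl -lecR -ncE normr_le0 subr_eq0 [_ / _]mulrC => /eqP.
exact: mulIf.
Qed.

(** The truncated exponent is harmless: the binomial coefficient is 0 for n < k. *)
Definition eigenseq k n : R[i] := ('C(n, k)%:R * t ^+ (n - k))%:C.

Lemma eigenseq_diag k : eigenseq k k = 1.
Proof. by rewrite /eigenseq binn subnn mulr1. Qed.

Lemma cesaro_eigenseq k : cesaro t (eigenseq k) = k.+1%:R^-1 *: eigenseq k.
Proof.
suff E n : cesaro t (eigenseq k) n = k.+1%:R^-1 * eigenseq k n by exact/funext.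
elim: n => [|n IH].
  rewrite cesaro0 /eigenseq; case: k => [|k]; first by rewrite invr1 mul1r.
  by rewrite bin0n mul0r mulr0.
rewrite cesaroS {}IH.
(* The row recurrence reduces the eigenvalue equation to this identity, a form of (n+1) C(n,k) =
   (n+1-k) C(n+1,k). *)
have binE : (n.+1 * 'C(n, k) + k.+1 * 'C(n.+1, k) = n.+2 * 'C(n.+1, k))%N.
  have [kn|nk] := leqP k n.+1; last by rewrite !bin_small ?muln0 ?(ltnW nk).
  by rewrite (mul_bin_down n.+1 k) -mulnDl addnS subnK.
have tE : t * 'C(n, k)%:R * t ^+ (n - k) = 'C(n, k)%:R * t ^+ (n.+1 - k).
  have [kn|nk] := leqP k n; first by rewrite subSn// exprS; ring.
  by rewrite bin_small// mulr0 !mul0r.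
have k0 : k.+1%:R != 0 :> R[i] by rewrite pnatr_eq0.
have n0 : n.+2%:R != 0 :> R[i] by rewrite pnatr_eq0.
apply: (mulIf n0); rewrite divfK//; apply: (mulfI k0); rewrite mulrA mulrDr.
rewrite [k.+1%:R * _ * _]mulrC mulVKf// mulrCA mulVKf//.
rewrite /eigenseq -!(rmorph_nat (real_complex R)) -!rmorphM -rmorphD.
congr _%:C.
rewrite [X in X + _](_ : _ = n.+1%:R * ('C(n, k)%:R * t ^+ (n.+1 - k))).
  by rewrite !mulrA -mulrDl -!natrM -natrD binE.
by rewrite -tE; ring.
Qed.

Lemma eigenseq_bounded k n : nc (eigenseq k n) <= (1 - t) ^- k.
Proof.
have /andP[t0 t1] := t01; have t1' : 0 < 1 - t by rewrite subr_gt0.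
rewrite nc_real ger0_norm; last by rewrite mulr_ge0// exprn_ge0.
rewrite -[leRHS]mul1r ler_pdivlMr ?exprn_gt0//.
have [kn|nk] := leqP k n; last by rewrite bin_small// !mul0r.
rewrite [leRHS](_ : _ = (t + (1 - t)) ^+ n); last by rewrite subrKC expr1n.
rewrite [leRHS]exprDn (bigD1 (Ordinal (kn : (k < n.+1)%N)))//=.
rewrite -mulrA mulr_natl lerDl; apply: sumr_ge0 => i _.
by rewrite mulrn_wge0// mulr_ge0// exprn_ge0// ltW.
Qed.

(** An eigenvector with nonzero eigenvalue is a multiple of its own image, and images of bounded
    sequences are null. *)
Lemma eigenseq_cvg0 k : eigenseq k @ \oo --> (0 : R[i]).
Proof.
have -> : eigenseq k = k.+1%:R *: cesaro t (eigenseq k).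
  by rewrite cesaro_eigenseq scalerA divff ?pnatr_eq0// scale1r.
have := cesaro_bounded_cvg0 t01 (eigenseq_bounded k).
by move=> /(cvgZl_tmp (k := k.+1%:R)); rewrite scaler0; apply.
Qed.

End CesaroEigenvectors.

(** * Abstract sup-normed sequence spaces, cylinder neighbourhoods and operator norms *)

Record sup_normed_sequences (R : realType) (X : normedModType R[i])
    (s : {linear X -> (nat -> R[i])}) : Prop := {
  sns_inj : injective s;
  sns_norm : forall x, nc x = supnorm (s x);
  sns_cvg : forall x, cvgn (s x);
  sns_null : forall u, u @ \oo --> (0 : R[i]) -> exists x, s x = u }.

(** Lets a cluster point for entrywise convergence be approached in finitely many entries at
    once. *)
Lemma nbhs_prod_topology (K : nat -> topologicalType) (a : prod_topology K) N
    (A : forall n, set (K n)) : (forall n, nbhs (a n) (A n)) ->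
  nbhs a [set b : prod_topology K | forall i : 'I_N, A i (b i)].
Proof.
move=> aA; apply: (@filter_forall (prod_topology K) 'I_N
  (fun i b => A i (b i)) (nbhs a)) => i.
exact: (@proj_continuous nat K i a _ (aA i)).
Qed.

Section Opnorm.
Variables (R : realType) (X : normedModType R[i]).

Lemma opnorm_le (T : X -> X) (M : R) :
  (forall x, nc x <= 1 -> nc (T x) <= M) -> (opnorm T <= M%:E)%E.
Proof.
move=> TM; apply: ge_ereal_sup => _ [x /= x1 <-]; rewrite lee_fin; apply: TM.
by rewrite -lecR -ncE.
Qed.

Lemma opnorm_ge (T : X -> X) x : nc x <= 1 -> ((nc (T x))%:E <= opnorm T)%E.
Proof.
by move=> x1; apply: ereal_sup_ubound; exists x => //=; rewrite ncE lecR.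
Qed.

Lemma opnorm_ge0 (T : X -> X) : (0 <= opnorm T)%E.
Proof.
apply: le_trans (opnorm_ge T (_ : nc (0 : X) <= 1)); last by rewrite normr0.
by rewrite lee_fin nc_ge0.
Qed.

Lemma bounded_continuous (T : {linear X -> X}) (B : R) : 0 <= B ->
  (forall x, nc (T x) <= B * nc x) -> continuous T.
Proof.
move=> B0 TB; apply: bounded_linear_continuous; apply/linear_boundedP.
near=> r => x; rewrite (ncE (T x)) (ncE x).
have Br : B%:C <= r.
  by near: r; apply: nbhs_pinfty_ge; rewrite ger0_real// ler0c.
apply: (@le_trans _ _ (B%:C * (nc x)%:C)); first by rewrite -rmorphM lecR.
by rewrite ler_wpM2r// ler0c nc_ge0.
Unshelve. all: by end_near. Qed.

End Opnorm.

(** * The operator on an abstract sequence space: norm, spectra, compactness, dynamics *)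

Section CesaroOperator.
Variables (R : realType) (t : R) (t01 : 0 <= t < 1).
Variables (X : normedModType R[i]) (s : {linear X -> (nat -> R[i])}).
Hypothesis sP : sup_normed_sequences s.
Variable T : {linear X -> X}.
Hypothesis sT : forall x, s (T x) = cesaro t (s x).
Implicit Types (x y : X) (l : R[i]).

Lemma entryD x y n : s (x + y) n = s x n + s y n.
Proof. by rewrite linearD. Qed.

Lemma entryB x y n : s (x - y) n = s x n - s y n.
Proof. by rewrite linearB. Qed.

Lemma entryZ l x n : s (l *: x) n = l * s x n.
Proof. by rewrite linearZ. Qed.

Lemma entry_le x n : nc (s x n) <= nc x.
Proof. by rewrite (sns_norm sP) -lecR -ncE supnorm_ub//; exact: sns_cvg. Qed.

Lemma norm_le x (M : R) : (forall n, nc (s x n) <= M) -> nc x <= M.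
Proof.
by move=> xM; rewrite (sns_norm sP); apply: supnorm_le => n; rewrite ncE lecR.
Qed.

Lemma iter_cesaro_le n x : nc (iter n T x) <= nc x.
Proof.
elim: n x => //= n IH x; apply: le_trans (IH x); apply: norm_le => m.
by rewrite sT; have [] := @cesaro_bound _ _ t01 (s (iter n T x)) m _
  (fun i _ => entry_le _ i).
Qed.

Lemma cesaro_eigenvector k : exists x, s x = eigenseq t k.
Proof. exact: (sns_null sP (eigenseq_cvg0 t01 k)). Qed.

(** The norm is attained at the fixed vector (t^n)_n. *)
Lemma cesaro_opnorm : opnorm T = 1%:E.
Proof.
apply/le_anti/andP; split.
  by apply: opnorm_le => x; apply: le_trans; exact: (iter_cesaro_le 1).
have [v sv] := cesaro_eigenvector 0.
have Tv : T v = v.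
  by apply: (sns_inj sP); rewrite sT sv cesaro_eigenseq invr1 scale1r.
have v1 : nc v <= 1.
  apply: norm_le => n; rewrite sv.
  by have := eigenseq_bounded t01 0 n; rewrite expr0 invr1.
apply: le_trans (opnorm_ge T v1); rewrite Tv lee_fin.
by have := entry_le v 0; rewrite sv eigenseq_diag normr1.
Qed.

Lemma cesaro_power_bounded : power_bounded T.
Proof.
apply: (@le_lt_trans _ _ 1%:E); last exact: ltry.
apply: ge_ereal_sup => _ [n _ <-]; apply: opnorm_le => x.
by apply: le_trans; exact: iter_cesaro_le.
Qed.

Lemma cesaro_point_spectrum : point_spectrum T = Lambda R.
Proof.
apply/seteqP; split => [l [x x0 Tx]|l [k _ <-]].
  have [||n ->] := @cesaro_eigenvalue _ _ t01 l (s x); last by exists n.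
    by rewrite -sT Tx linearZ.
  by move=> sx0; case/eqP: x0; apply: (sns_inj sP); rewrite linear0.
have [x sx] := cesaro_eigenvector k; exists x.
  apply/eqP => x0; have := eigenseq_diag t k; rewrite -sx x0 linear0.
  by move/esym/eqP; rewrite oner_eq0.
by apply: (sns_inj sP); rewrite sT linearZ sx cesaro_eigenseq.
Qed.

Lemma unit_vector n : exists x, forall m, s x m = (m == n)%:R.
Proof.
have [|x sx] := @sns_null _ _ _ sP (fun m => (m == n)%:R).
  apply: cvg_near_cst; exists n.+1 => // m /= nm.
  by rewrite gtn_eqF.
by exists x => m; rewrite sx.
Qed.

(* The coordinate functionals f(x) = x_0 and g(x) = x_1 - t x_0 satisfy
   f(Tx) = f(x) and g(Tx) = g(x)/2, so that |f(x)||g| <= |g(x)||f| along the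
   projective orbit of x, hence everywhere if that orbit is dense. *)
Lemma cesaro_not_supercyclic : ~ supercyclic T.
Proof.
move=> [x dx]; pose g y : R[i] := s y 1 - t%:C * s y 0.
have fT n : s (iter n T x) 0 = s x 0.
  by elim: n => //= n IH; rewrite sT cesaro0.
have gT n : nc (g (iter n T x)) <= nc (g x).
  elim: n => [|n IH]; rewrite ?iterS//; apply: le_trans IH.
  have -> : g (T (iter n T x)) = g (iter n T x) / 2.
    by rewrite /g sT cesaroS cesaro0; field.
  by rewrite ncM ncV nc_nat ler_pdivrMr// ler_peMr ?nc_ge0// ler1n.
(* Both sides of the inequality scale by |l|, so it holds on the whole projective orbit, which meets
   every ball. *)
have approx z (e : R) : 0 < e -> exists2 y, nc (z - y) < e &
    nc (s x 0) * nc (g y) <= nc (g x) * nc (s y 0).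
  move=> e0.
  have [||y [zy [l [n yE]]]] := dx (ball z e%:C).
  - by exists z; apply: ballxx; rewrite ltcR.
  - by apply: ball_open; rewrite ltcR.
  exists y; first by move: zy; rewrite -ball_normE /= ncE ltcR.
  have -> : g y = l * g (iter n T x).
    by rewrite yE /g !entryZ mulrBr mulrCA.
  rewrite yE entryZ fT !ncM mulrCA [leRHS]mulrCA ler_wpM2l ?nc_ge0//.
  by rewrite mulrC ler_wpM2r ?nc_ge0.
have [e0 e0E] := unit_vector 0; have [e1 e1E] := unit_vector 1.
(* If x_0 = 0, the orbit has zero first entry and stays at distance at least 1 from [e0]. *)
have fx : 0 < nc (s x 0).
  rewrite lt_neqAle nc_ge0 andbT eq_sym; apply/eqP => fx0.
  have [||y [ey [l [n yE]]]] := dx (ball e0 1).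
  - by exists e0; exact: ballxx.
  - by apply: ball_open.
  have := entry_le (e0 - y) 0.
  have sx0 : s x 0 = 0 by apply/eqP; rewrite -normr_eq0 ncE fx0.
  rewrite entryB e0E yE entryZ fT sx0 mulr0 subr0 normr1 /= leNgt.
  by move: ey; rewrite -ball_normE /= -yE ncE ltcR => ->.
pose a := nc (s x 0); pose b := nc (g x).
have b0 : 0 <= b by exact: nc_ge0.
(* An orbit point [y] within [e] of [e1] has |y_0| <= e and |g(y)| >= 1 - 2e, whence a <= (2a + b)
   e; this [e] is too small for that. *)
pose e := a / (2 * a + b + 1).
have e_gt0 : 0 < e by rewrite divr_gt0//; lra.
have [y ey] := approx e1 e e_gt0; rewrite -/a -/b => aby.
pose d := e1 - y.
have dE n : nc (s d n) <= e by apply: le_trans (entry_le d n) (ltW ey).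
have y0E : s y 0 = - s d 0 by rewrite entryB e1E sub0r opprK.
have gyE : 1 = g y + (s d 1 - t%:C * s d 0).
  by rewrite /g /d !entryB !e1E /= sub0r; ring.
have gy : 1 <= nc (g y) + (e + e).
  have /andP[t0 t1] := t01.
  have -> : 1 = nc (1 : R[i]) by rewrite normr1.
  rewrite {1}gyE; apply: le_trans (ncD _ _) _; rewrite lerD2l.
  apply: le_trans (ncD _ _) _; apply: lerD => //.
  rewrite normrN ncM nc_real ger0_norm//.
  by apply: le_trans (dE 0); rewrite ler_piMl ?nc_ge0// ltW.
have y0e : nc (s y 0) <= e by rewrite y0E normrN.
have abe : a * nc (g y) <= b * e.
  by apply: le_trans aby _; rewrite ler_wpM2l.
have ea : e * (2 * a + b + 1) = a by rewrite /e divfK// lt0r_neq0//; lra.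
have := ler_wpM2l (ltW fx) gy; rewrite -/a.
move: (nc (g y)) abe => G; nra.
Qed.

(** Serves both the spectrum, with l off the diagonal, and mean ergodicity, with l = 1. *)
Lemma cesaro_resolvent_eq l : l != 0 -> exists2 B : R, 0 <= B &
  forall y, (forall n, l = n.+1%:R^-1 -> n = 0%N /\ s y n = 0) ->
  exists x, [/\ l *: x - T x = y, resonance_free l (s x) & nc x <= B * nc y].
Proof.
move=> l0; have [B B0 HB] := resolvent_bound t01 l0; exists B => // y ly.
pose u := resolvent_seq t l (s y).
have uE : l *: u - cesaro t u = s y by exact: resolvent_seqP.
have lu : resonance_free l u.
  by move=> n ln; rewrite /u /resolvent_seq -ln subrr invr0 mulr0.
have uB n : nc (u n) <= B * nc y.
  apply: HB => // m; apply: le_trans (entry_le y m).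
  by rewrite -uE.
(* The bounded solution [u] lies in X because u = (y + C_t u) / l and C_t u is a null sequence. *)
have [z sz] := sns_null sP (cesaro_bounded_cvg0 t01 uB).
have sx : s (l^-1 *: (y + z)) = u.
  by rewrite linearZ linearD/= -uE sz subrK scalerA mulVf// scale1r.
exists (l^-1 *: (y + z)); split.
- by apply: (sns_inj sP); rewrite linearB linearZ /= sT sx.
- by rewrite sx.
- by apply: norm_le => n; rewrite sx.
Qed.

Lemma cesaro_spectrum : spectrum T = Lambda0 R.
Proof.
apply/seteqP; split => [l|l].
  apply: contra_notP => lL0.
  have l0 : l != 0 by apply/eqP => l0; apply: lL0; right.
  have lL n : l <> n.+1%:R^-1 by move=> ln; apply: lL0; left; exists n.
  have [B B0 HB] := cesaro_resolvent_eq l0.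
  have /choice[S SP] : forall y, exists x,
      l *: x - T x = y /\ nc x <= B * nc y.
    by move=> y; have [n /lL//|x [xE _ xB]] := HB y; exists x.
  pose U x := l *: x - T x.
  have Ulin k x y : U (k *: x + y) = k *: U x + U y.
    rewrite /U linearP/= scalerDr scalerA [l * k]mulrC -scalerA opprD addrACA.
    by rewrite -scalerBr.
  (* Since l is not an eigenvalue, [U] is injective; this makes the pointwise choice [S] linear and
     a two-sided inverse. *)
  have Uinj : injective U.
    move=> x y Uxy; apply: contrapT => /eqP; rewrite -subr_eq0 => xy0.
    suff : point_spectrum T l.
      by rewrite cesaro_point_spectrum => -[n _ /esym/lL].
    exists (x - y) => //; apply/esym/eqP; rewrite -subr_eq0; apply/eqP.
    rewrite -[LHS]/(U (x - y)) addrC -scaleN1r Ulin scaleN1r Uxy.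
    exact: addNr.
  have Slin : linear S.
    by move=> k x y; apply: Uinj; rewrite Ulin /U (SP _).1 (SP x).1 (SP y).1.
  pose F : {linear X -> X} := HB.pack S (GRing.isLinear.Build _ _ _ _ S Slin).
  exists F; split.
  - by apply: (bounded_continuous B0) => x; exact: (SP x).2.
  - by move=> x; apply: Uinj; exact: (SP _).1.
  - by move=> x; exact: (SP x).1.
move=> lL [S [Scont lS Sl]].
have eigen k : exists2 v, T v = k.+1%:R^-1 *: v & v != 0.
  have : point_spectrum T k.+1%:R^-1.
    by rewrite cesaro_point_spectrum; exists k.
  by case=> v; exists v.
case: lL => [[k _ lk]|/= l0].
  have [v Tv /eqP] := eigen k; apply.
  by have := lS v; rewrite -lk Tv subrr linear0.
have [r [r0 Sr]] : exists r : R, 0 <= r /\ forall x, nc (S x) <= r * nc x.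
  have := continuous_linear_bounded 0 (Scont 0) => /linear_boundedP.
  move=> /pinfty_ex_gt0[r r0 Sr]; exists (nc r); split; first exact: nc_ge0.
  move=> x; have := Sr x; rewrite (ncE (S x)) (ncE x) -{1}(gtr0_norm r0).
  by rewrite (ncE r) -rmorphM lecR.
(* At l = 0, an inverse of bound [r] would give |v| <= r |v| / (k + 1) for every eigenvector; k =
   [Num.bound r] contradicts this. *)
have [v Tv v0] := eigen (Num.bound r).
have := Sr (- T v); have := lS v; rewrite l0 scale0r sub0r => ->.
rewrite Tv normrN ncZ ncV nc_nat mulrA mulrC => vr.
have v_gt0 : 0 < nc v by rewrite -ltcR -ncE normr_gt0.
have : 1 <= r / (Num.bound r).+1%:R.
  by rewrite -(ler_pM2l v_gt0) mulr1.
rewrite ler_pdivlMr// mul1r leNgt => /negP; apply.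
by apply: lt_trans (archi_boundP r0) _; rewrite ltr_nat.
Qed.

(* On sequences dominated by a null sequence, entrywise convergence is
   convergence in norm, and Tychonoff's theorem applies. *)
Lemma cesaro_compact : compact_operator T.
Proof.
pose M n : R := (1 - t)^-1 / n.+1%:R.
pose K := [set x | forall n, complex_square (M n) (s x n)].
have TK : T @` [set x | `|x| <= 1] `<=` K.
  move=> _ [x x1 <-] n; apply: mem_complex_square; rewrite sT.
  have xn i : nc (s x i) <= 1.
    by apply: le_trans (entry_le x i) _; rewrite -lecR -ncE.
  have [_] := @cesaro_bound _ _ t01 (s x) n 1 (fun i _ => xn i).
  by rewrite div1r.
have M0 e : 0 < e -> exists N, forall n, (N <= n)%N -> M n < e.
  have : M @ \oo --> (0 : R).
    rewrite -(mulr0 (1 - t)^-1).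
    by apply: cvgM; [exact: cvg_cst|exact: cvg_harmonic].
  move=> /cvgr0Pnorm_lt + e0 => /(_ _ e0) [N _ NM].
  by exists N => n /NM; apply: le_lt_trans; exact: ler_norm.
apply: precompact_subset TK _.
apply: compact_precompact; first exact: norm_hausdorff.
move=> F PF FK.
have := @tychonoff nat (fun=> R[i]) (fun n => complex_square (M n)).
move=> /(_ (fun n => @compact_complex_square R (M n))).
move=> /(_ (fmap s F) _)[|a [aK sFa]]; first exact: FK.
(* The cluster point inherits the domination by 2 [M n], so it represents an element of X. *)
have a0 : a @ \oo --> (0 : R[i]).
  apply/cvgr0Pnorm_le => e e0.
  have eR : e = (nc e)%:C by rewrite -normRe gtr0_norm.
  have e0' : 0 < nc e / 2 by rewrite divr_gt0// -ltcR -eR.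
  have [N NM] := M0 _ e0'; exists N => // n /NM Mn /=.
  rewrite eR normRe lecR; apply: le_trans (complex_square_le (aK n)) _.
  by rewrite mulrC -ler_pdivlMr// ltW.
have [x sx] := sns_null sP a0.
exists x; split; first by move=> n; rewrite sx; exact: aK.
move=> B C FB /nbhs_ballP[e e0 eC].
have eR : e = (nc e)%:C by rewrite -normRe gtr0_norm.
(* Tail entries of both sequences are at most 2 [M n], so they differ by at most 4 [M n], which must
   stay below e / 2. *)
have e0' : 0 < nc e / 8 by rewrite divr_gt0// -ltcR -eR.
have [N NM] := M0 _ e0'.
pose K' : nat -> topologicalType := fun=> R[i].
have near_a : nbhs (a : prod_topology K')
    [set b : prod_topology K' | forall i : 'I_N, ball (a i) (e / 2) (b i)].
  apply: (@nbhs_prod_topology K' a N (fun i => ball (a i) (e / 2))) => i.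
  by apply: nbhsx_ballx; rewrite divr_gt0.
have sFBK : F (s @^-1` (s @` (B `&` K))).
  by apply: filterS (filterI FB FK) => y yBK; exists y.
have [_ [[y [By Ky] <-] ya]] := sFa _ _ sFBK near_a.
exists y; split => //; apply: eC; rewrite -ball_normE.
suff : `|x - y| < e by [].
rewrite eR (ncE (x - y)) ltcR.
have : 0 < nc e by rewrite -ltcR -eR.
suff : nc (x - y) <= nc e / 2 by lra.
apply: norm_le => n; rewrite entryB sx; have [nN|Nn] := ltnP n N.
  have : `|a n - s y n| < e / 2.
    by have := ya (Ordinal nN); rewrite -ball_normE.
  move=> /ltW; rewrite (normRe (_ - _)) {1}eR -(rmorph_nat (real_complex R) 2).
  by rewrite -fmorphV -rmorphM lecR.
apply: le_trans (ncD _ _) _; rewrite normrN.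
have := complex_square_le (aK n); have := complex_square_le (Ky n).
by have := NM _ Nn; lra.
Qed.

(** Writing x - P x = z - T z makes the sum of iterates telescope, with z bounded uniformly over the
    unit ball. *)
Lemma cesaro_uniformly_mean_ergodic : uniformly_mean_ergodic T.
Proof.
have [v sv] := cesaro_eigenvector 0.
have Tv : T v = v.
  by apply: (sns_inj sP); rewrite sT sv cesaro_eigenseq invr1 scale1r.
have v1 : nc v <= 1.
  apply: norm_le => n; rewrite sv.
  by have := eigenseq_bounded t01 0 n; rewrite expr0 invr1.
pose P x := s x 0 *: v.
have Plin : linear P by move=> l x y; rewrite /P entryD entryZ scalerDl scalerA.
have PB x : nc (P x) <= nc x.
  rewrite ncZ -[leRHS]mulr1; apply: ler_pM; rewrite ?nc_ge0//.
  exact: entry_le.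
pose F : {linear X -> X} := HB.pack P (GRing.isLinear.Build _ _ _ _ P Plin).
exists F.
  by apply: (bounded_continuous ler01) => x; rewrite mul1r; exact: PB.
have [B B0 HB] := cesaro_resolvent_eq (oner_neq0 R[i]).
have iterD n x y : iter n T (x + y) = iter n T x + iter n T y.
  by elim: n => //= n ->; rewrite linearD.
have iterP n x : iter n T (P x) = P x.
  by elim: n => //= n ->; rewrite /P linearZ Tv.
(* Here |x - P x| <= 2, so |z| <= 2B, and two iterates of z remain after telescoping: hence 4B. *)
have mean_le n x : nc x <= 1 ->
    nc (cesaro_mean T n.+1 x - F x) <= 4 * B / n.+1%:R.
  move=> x1; rewrite -[F x]/(P x).
  have [|z [zE _ zB]] := HB (x - P x).
    (* For l = 1 the only resonance is at entry 0, where x - P x vanishes because v_0 = 1. *)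
    move=> m /esym/eqP; rewrite invr_eq1 pnatr_eq1 => /eqP[->]; split=> //.
    by rewrite entryB entryZ sv eigenseq_diag mulr1 subrr.
  have zx : nc z <= 2 * B.
    apply: le_trans zB _; rewrite mulrC ler_wpM2r//.
    apply: le_trans (ncD _ _) _; rewrite normrN.
    by have := PB x; lra.
  have -> : cesaro_mean T n.+1 x - P x =
      n.+1%:R^-1 *: (T z - iter n.+2 T z).
    have xE m : iter m T x = (- iter m.+1 T z - - iter m T z) + P x.
      have {1}-> : x = (z - T z) + P x by rewrite -[X in X - _]scale1r zE subrK.
      rewrite iterD iterP opprK [- _ + _]addrC iterSr; congr (_ + _).
      by elim: m => //= m ->; rewrite linearB.
    rewrite /cesaro_mean; under eq_bigr do rewrite xE.
    rewrite big_split/= telescope_sumr// sumr_const_nat subn1/= opprK.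
    rewrite [- _ + _]addrC scalerDr -[P x *+ _]scaler_nat scalerA.
    by rewrite mulVf ?pnatr_eq0// scale1r addrK.
  rewrite ncZ ncV nc_nat mulrC ler_wpM2r//.
  apply: le_trans (ncD _ _) _; rewrite normrN.
  have := iter_cesaro_le 1 z; have := iter_cesaro_le n.+2 z.
  rewrite -[iter 1 T z]/(T z); lra.
have mean_bounds : \forall n \near \oo,
    (cst 0 n <= opnorm (fun x => (cesaro_mean T n.+1 x - F x)%R)
      <= (4 * B / n.+1%:R)%:E)%E.
  by apply: nearW => n; rewrite opnorm_ge0 opnorm_le//; exact: mean_le.
suff mean_cvg :
    opnorm (fun x => cesaro_mean T n.+1 x - F x) @[n --> \oo] --> 0%E.
  by rewrite -cvg_shiftS; exact: mean_cvg.
apply: (squeeze_cvge mean_bounds); first exact: cvg_cst.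
apply: cvg_EFin; first exact: nearW.
rewrite -(mulr0 (4 * B)); apply: cvgM; first exact: cvg_cst.
exact: cvg_harmonic.
Qed.

End CesaroOperator.

(** * Application to c and c_0 *)

Lemma cspace_sup_normed (R : realType) :
  sup_normed_sequences (\val : {linear cspace R -> (nat -> R[i])}).
Proof.
split; [exact: val_inj|by []|exact: cspace_cvg|] => u u0.
have uP : u \in @cvg_seqs R by apply/asboolP/cvg_ex; exists 0.
by exists (CSpace uP).
Qed.

Lemma c0space_sup_normed (R : realType) :
  sup_normed_sequences (\val : {linear c0space R -> (nat -> R[i])}).
Proof.
split; [exact: val_inj|by []|exact: c0space_cvg|] => u u0.
have uP : u \in @null_seqs R by exact/asboolP.
by exists (C0Space uP).
Qed.

Lemma cesaro_cE (R : realType) (t : R) (ht : 0 <= t < 1) (x : cspace R) :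
  (\val : {linear cspace R -> (nat -> R[i])}) (cesaro_c ht x) =
  cesaro t ((\val : {linear cspace R -> (nat -> R[i])}) x).
Proof. exact: (erefl (cesaro t (cseq x))). Qed.

Lemma cesaro_c0E (R : realType) (t : R) (ht : 0 <= t < 1) (x : c0space R) :
  (\val : {linear c0space R -> (nat -> R[i])}) (cesaro_c0 ht x) =
  cesaro t ((\val : {linear c0space R -> (nat -> R[i])}) x).
Proof. exact: (erefl (cesaro t (c0seq x))). Qed.

Theorem proposition5p2 (R : realType) (t : R) (ht : 0 <= t < 1) :
  (opnorm (cesaro_c0 ht) = 1%:E /\ opnorm (cesaro_c ht) = 1%:E) /\
  (compact_operator (cesaro_c0 ht) /\ compact_operator (cesaro_c ht)) /\
  (point_spectrum (cesaro_c0 ht) = Lambda R /\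
   point_spectrum (cesaro_c ht) = Lambda R) /\
  (spectrum (cesaro_c0 ht) = Lambda0 R /\
   spectrum (cesaro_c ht) = Lambda0 R) /\
  (power_bounded (cesaro_c0 ht) /\ power_bounded (cesaro_c ht)) /\
  (uniformly_mean_ergodic (cesaro_c0 ht) /\
   uniformly_mean_ergodic (cesaro_c ht)) /\
  (~ supercyclic (cesaro_c0 ht) /\ ~ supercyclic (cesaro_c ht)).
Proof.
pose c0P := c0space_sup_normed R; pose cP := cspace_sup_normed R.
pose c0E := cesaro_c0E ht; pose cE := cesaro_cE ht.
do ![split].
- exact: (cesaro_opnorm ht c0P c0E).
- exact: (cesaro_opnorm ht cP cE).
- exact: (cesaro_compact ht c0P c0E).
- exact: (cesaro_compact ht cP cE).
- exact: (cesaro_point_spectrum ht c0P c0E).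
- exact: (cesaro_point_spectrum ht cP cE).
- exact: (cesaro_spectrum ht c0P c0E).
- exact: (cesaro_spectrum ht cP cE).
- exact: (cesaro_power_bounded ht c0P c0E).
- exact: (cesaro_power_bounded ht cP cE).
- exact: (cesaro_uniformly_mean_ergodic ht c0P c0E).
- exact: (cesaro_uniformly_mean_ergodic ht cP cE).
- exact: (cesaro_not_supercyclic ht c0P c0E).
- exact: (cesaro_not_supercyclic ht cP cE).
Qed.
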